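(* Let $F$ be a field of characteristic different from two, let $k\geq 4$ be an integer and let $n=4k+1$. Then there exists a maximal commutative subalgebra $A$ of the Grassmann algebra $G(n)$ over $F$ such that $\dim_F(A)<3\cdot 2^{n-2}$.
   Context: For a field $F$ of characteristic different from two, the Grassmann algebra (exterior algebra) $G(n)$ of rank $n$ over $F$ is the associative unital $F$-algebra generated by $x_1,\ldots,x_n$ subject to the relations $x_ix_j+x_jx_i=0$ for all $1\leq i,j\leq n$ (in particular $x_i^2=0$); that is, the quotient of the free associative algebra on $x_1,\dots,x_n$ by the two-sided ideal generated by the elements $x_ix_j+x_jx_i$. It has dimension $2^n$ over $F$. A maximal commutative subalgebra of $G(n)$ means a commutative subalgebra of $G(n)$ that is maximal with respect to inclusion among commutative subalgebras of $G(n)$. *)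

(* Defs.v *)
From HB Require Import structures.
From mathcomp Require Import all_boot all_order all_algebra all_field.
From mathcomp Require Import boolp.
From mathcomp Require Import finmap monalg.

Set Implicit Arguments.
Unset Strict Implicit.
Unset Printing Implicit Defensive.

Import GRing.Theory.
Local Open Scope ring_scope.
Local Open Scope quotient_scope.

Inductive two_sided_ideal (R : nzRingType) (S : R -> Prop) : R -> Prop :=
  | two_sided_ideal_gen p of S p : two_sided_ideal S p
  | two_sided_ideal0 : two_sided_ideal S 0
  | two_sided_idealB p q of two_sided_ideal S p & two_sided_ideal S q :
      two_sided_ideal S (p - q)
  | two_sided_idealMl a p of two_sided_ideal S p : two_sided_ideal S (a * p)
  | two_sided_idealMr a p of two_sided_ideal S p : two_sided_ideal S (p * a).

(* The free associative unital algebra on n generators: the monoid algebra of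
   the free monoid on 'I_n. *)
(* The casts pin the canonical structures so that they agree with those used
   in the monoid algebra library. *)
Notation free_algebra F n :=
  {malg (F : nzRingType)[({fmonom 'I_n} : monomType)]}.

(* Locked, like the operations of the quotient below: unification would
   otherwise unfold them down to finitely supported functions. *)
HB.lock Definition free_gen (F : fieldType) (n : nat) (i : 'I_n) :
  free_algebra F n := << fmu i >>.

Definition grassmann_relator (F : fieldType) (n : nat) (p : free_algebra F n) :=
  exists i j : 'I_n,
    p = free_gen F i * free_gen F j + free_gen F j * free_gen F i.

Definition grassmann_ideal (F : fieldType) (n : nat) : {pred free_algebra F n} :=
  fun p => `[< two_sided_ideal (@grassmann_relator F n) p >].

Section GrassmannIdeal.
Variables (F : fieldType) (n : nat).
Local Notation A := (free_algebra F n).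
Local Notation I := (@grassmann_ideal F n).

Lemma grassmann_idealP (p : A) :
  reflect (two_sided_ideal (@grassmann_relator F n) p) (p \in I).
Proof. exact: asboolP. Qed.

Lemma grassmann_ideal_zmod_closed : zmod_closed I.
Proof.
split=> [|p q /grassmann_idealP Ip /grassmann_idealP Iq];
  apply/grassmann_idealP; first exact: two_sided_ideal0.
exact: two_sided_idealB.
Qed.

HB.instance Definition _ :=
  GRing.isZmodClosed.Build A I grassmann_ideal_zmod_closed.

Lemma grassmann_idealMl (a p : A) : p \in I -> a * p \in I.
Proof. by move=> /grassmann_idealP Ip; apply/asboolP/two_sided_idealMl. Qed.

Lemma grassmann_idealMr (a p : A) : p \in I -> p * a \in I.
Proof. by move=> /grassmann_idealP Ip; apply/asboolP/two_sided_idealMr. Qed.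

Lemma mcoeff1_free_gen (i : 'I_n) : (free_gen F i)@_mone = 0.
Proof.
rewrite free_gen.unlock mcoeffU; case: eqP => // /(congr1 (@fdeg _)).
by rewrite fdegU fdeg1.
Qed.

Lemma grassmann_ideal_mcoeff1 (p : A) : p \in I -> p@_mone = 0.
Proof.
have cM (q r : A) : (q * r)@_mone = q@_mone * r@_mone.
  exact: (mcoeff1g_is_multiplicative _ F).1.
move=> /grassmann_idealP; elim=> {p}.
- move=> p [i [j ->]].
  have c0 (l m : 'I_n) : (free_gen F l * free_gen F m)@_mone = 0.
    by apply: etrans (cM _ _) _; rewrite mcoeff1_free_gen mul0r.
  apply: etrans (mcoeffD _ _ _) _.
  by rewrite [X in X + _](c0 i j) [X in _ + X](c0 j i) addr0.
- exact: mcoeff0.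
- by move=> p q _ p0 _ q0; rewrite mcoeffB p0 q0 subr0.
- by move=> a p _ p0; rewrite cM p0 mulr0.
- by move=> a p _ p0; rewrite cM p0 mul0r.
Qed.

Lemma grassmann_ideal1 : (1 : A) \in I = false.
Proof.
by apply/negP => /grassmann_ideal_mcoeff1/eqP; rewrite rmorph1 oner_eq0.
Qed.

Lemma free_scalerAr (c : F) (p q : A) : c *: (p * q) = p * (c *: q).
Proof.
have cC : c%:MP * p = p * c%:MP.
  rewrite !malgM_def fgmulUg fgmulgU; apply: eq_bigr => k _.
  by rewrite mulrC mul1m mulm1.
apply: etrans (esym (mul_malgC _ _)) _; apply: etrans (mulrA _ _ _) _.
rewrite cC; apply: etrans (esym (mulrA _ _ _)) _.
by congr (_ * _); apply: mul_malgC.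
Qed.

Lemma grassmann_idealZ (c : F) (p : A) : p \in I -> c *: p \in I.
Proof.
by move=> Ip; rewrite -[p]mul1r scalerAl grassmann_idealMl.
Qed.

End GrassmannIdeal.

(* In characteristic two the relations x_i x_j + x_j x_i = 0 do not force
   x_i ^+ 2 = 0 and the quotient is an infinite-dimensional polynomial ring;
   hence the proof argument, which the instances below rely on. *)
Definition grassmann (F : fieldType) (charF : 2%N \notin [pchar F]) (n : nat) :=
  {ideal_quot (@grassmann_ideal F n)}.

Section GrassmannZmodule.
Variables (F : fieldType) (charF : 2%N \notin [pchar F]) (n : nat).
Local Notation G := (grassmann charF n).
HB.instance Definition _ := EqQuotient.on G.
HB.instance Definition _ := GRing.Zmodule.on G.
End GrassmannZmodule.

HB.lock Definition grassmann_mul (F : fieldType) (charF : 2%N \notin [pchar F])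
  (n : nat) (x y : grassmann charF n) : grassmann charF n :=
  \pi_(grassmann charF n) (repr x * repr y).

HB.lock Definition grassmann_scale (F : fieldType) (charF : 2%N \notin [pchar F])
  (n : nat) (c : F) (x : grassmann charF n) : grassmann charF n :=
  \pi_(grassmann charF n) (c *: repr x).

HB.lock Definition grassmann_pi (F : fieldType) (charF : 2%N \notin [pchar F])
  (n : nat) (p : free_algebra F n) : grassmann charF n :=
  \pi_(grassmann charF n) p.

Section GrassmannAlgebra.
Variables (F : fieldType) (charF : 2%N \notin [pchar F]) (n : nat).
Local Notation A := (free_algebra F n).
Local Notation I := (@grassmann_ideal F n).
Local Notation G := (grassmann charF n).
Local Notation pi := (@grassmann_pi F charF n).
Local Notation mul := (@grassmann_mul F charF n).
Local Notation scale := (@grassmann_scale F charF n).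

Lemma grassmann_piP (p q : A) : reflect (pi p = pi q) (p - q \in I).
Proof. by rewrite grassmann_pi.unlock Quotient.idealrBE; apply: eqP. Qed.

Lemma grassmann_pi_surj (x : G) : exists p : A, x = pi p.
Proof. by exists (repr x); rewrite grassmann_pi.unlock reprK. Qed.

Lemma grassmann_reprP (p : A) : repr (pi p) - p \in I.
Proof. by apply/grassmann_piP; rewrite grassmann_pi.unlock reprK. Qed.

Fact grassmann_piD (p q : A) : pi (p + q) = pi p + pi q.
Proof. by rewrite grassmann_pi.unlock; apply: Quotient.pi_add. Qed.

Fact grassmann_pi0 : pi 0 = 0.
Proof. by apply: (addrI (pi 0)); rewrite -grassmann_piD !addr0. Qed.

Fact grassmann_piM (p q : A) : pi (p * q) = mul (pi p) (pi q).
Proof.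
have -> : mul (pi p) (pi q) = pi (repr (pi p) * repr (pi q)).
  by rewrite grassmann_mul.unlock grassmann_pi.unlock.
apply/esym/grassmann_piP; set p' := repr _; set q' := repr _.
have -> : p' * q' - p * q = p' * (q' - q) + (p' - p) * q.
  by rewrite mulrBr mulrBl addrA subrK.
apply: rpredD.
  exact/grassmann_idealMl/grassmann_reprP.
exact/grassmann_idealMr/grassmann_reprP.
Qed.

Fact grassmann_piZ (c : F) (p : A) : pi (c *: p) = scale c (pi p).
Proof.
have -> : scale c (pi p) = pi (c *: repr (pi p)).
  by rewrite grassmann_scale.unlock grassmann_pi.unlock.
by apply/esym/grassmann_piP; rewrite -scalerBr grassmann_idealZ ?grassmann_reprP.
Qed.

Fact grassmann_mulA : associative mul.
Proof.
move=> x y z; have [p ->] := grassmann_pi_surj x.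
have [q ->] := grassmann_pi_surj y; have [r ->] := grassmann_pi_surj z.
by rewrite -!grassmann_piM mulrA.
Qed.

Fact grassmann_mul1x : left_id (pi 1) mul.
Proof.
by move=> x; have [p ->] := grassmann_pi_surj x; rewrite -grassmann_piM mul1r.
Qed.

Fact grassmann_mulx1 : right_id (pi 1) mul.
Proof.
by move=> x; have [p ->] := grassmann_pi_surj x; rewrite -grassmann_piM mulr1.
Qed.

Fact grassmann_mulDl : left_distributive mul +%R.
Proof.
move=> x y z; have [p ->] := grassmann_pi_surj x.
have [q ->] := grassmann_pi_surj y; have [r ->] := grassmann_pi_surj z.
by rewrite -grassmann_piD -!grassmann_piM -grassmann_piD mulrDl.
Qed.

Fact grassmann_mulDr : right_distributive mul +%R.
Proof.
move=> x y z; have [p ->] := grassmann_pi_surj x.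
have [q ->] := grassmann_pi_surj y; have [r ->] := grassmann_pi_surj z.
by rewrite -grassmann_piD -!grassmann_piM -grassmann_piD mulrDr.
Qed.

Fact grassmann_oner_neq0 : pi 1 != 0.
Proof.
apply/eqP; rewrite -grassmann_pi0 => /grassmann_piP.
by rewrite subr0 grassmann_ideal1.
Qed.

HB.instance Definition _ := GRing.Zmodule_isNzRing.Build G
  grassmann_mulA grassmann_mul1x grassmann_mulx1 grassmann_mulDl
  grassmann_mulDr grassmann_oner_neq0.

Fact grassmann_scaleA (a b : F) (x : G) :
  scale a (scale b x) = scale (a * b) x.
Proof.
by have [p ->] := grassmann_pi_surj x; rewrite -!grassmann_piZ scalerA.
Qed.

Fact grassmann_scale1 : left_id 1 scale.
Proof.
by move=> x; have [p ->] := grassmann_pi_surj x; rewrite -grassmann_piZ scale1r.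
Qed.

Fact grassmann_scaleDr : right_distributive scale +%R.
Proof.
move=> c x y; have [p ->] := grassmann_pi_surj x.
have [q ->] := grassmann_pi_surj y.
by rewrite -grassmann_piD -!grassmann_piZ -grassmann_piD scalerDr.
Qed.

Fact grassmann_scaleDl (x : G) : {morph scale^~ x : a b / a + b}.
Proof.
move=> a b; have [p ->] := grassmann_pi_surj x.
by rewrite -!grassmann_piZ -grassmann_piD scalerDl.
Qed.

HB.instance Definition _ := GRing.Zmodule_isLmodule.Build F G
  grassmann_scaleA grassmann_scale1 grassmann_scaleDr grassmann_scaleDl.

Fact grassmann_scaleAl (c : F) (x y : G) : c *: (x * y) = (c *: x) * y.
Proof.
have [p ->] := grassmann_pi_surj x; have [q ->] := grassmann_pi_surj y.
apply: etrans (_ : pi (c *: (p * q)) = _).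
  by rewrite grassmann_piZ grassmann_piM.
by rewrite scalerAl grassmann_piM grassmann_piZ.
Qed.

HB.instance Definition _ := GRing.Lmodule_isLalgebra.Build F G grassmann_scaleAl.

Fact grassmann_scaleAr (c : F) (x y : G) : c *: (x * y) = x * (c *: y).
Proof.
have [p ->] := grassmann_pi_surj x; have [q ->] := grassmann_pi_surj y.
apply: etrans (_ : pi (c *: (p * q)) = _).
  by rewrite grassmann_piZ grassmann_piM.
by rewrite free_scalerAr grassmann_piM grassmann_piZ.
Qed.

HB.instance Definition _ := GRing.Lalgebra_isAlgebra.Build F G grassmann_scaleAr.

Fact grassmann_pi_linear : linear pi.
Proof. by move=> c p q; rewrite grassmann_piD grassmann_piZ. Qed.

Fact grassmann_pi_monoid_morphism : monoid_morphism pi.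
Proof. by split=> [|p q]; [|exact: grassmann_piM]. Qed.

HB.instance Definition _ :=
  GRing.isLinear.Build F A G _ pi grassmann_pi_linear.
HB.instance Definition _ :=
  GRing.isMonoidMorphism.Build A G pi grassmann_pi_monoid_morphism.

Definition grassmann_gen (i : 'I_n) : G := pi (free_gen F i).

Lemma grassmann_pi_eq0 (p : A) : (pi p == 0) = (p \in I).
Proof.
by rewrite -(rmorph0 pi); apply/eqP/idP => [/grassmann_piP|Ip];
  [|apply/grassmann_piP]; rewrite subr0.
Qed.

Lemma grassmann_genN (i j : 'I_n) :
  grassmann_gen i * grassmann_gen j = - (grassmann_gen j * grassmann_gen i).
Proof.
apply/eqP; rewrite -addr_eq0 -!rmorphM -rmorphD grassmann_pi_eq0.
by apply/grassmann_idealP/two_sided_ideal_gen; exists i, j.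
Qed.

Lemma grassmann_gen_sqr (i : 'I_n) : grassmann_gen i * grassmann_gen i = 0.
Proof.
have /eqP := grassmann_genN i i; rewrite -addr_eq0 -mulr2n -scaler_nat.
rewrite scaler_eq0 => /orP[/eqP c2|/eqP //].
by case/negP: charF; rewrite inE /= c2 eqxx.
Qed.

(* Finite-dimensionality: the free algebra acts on functions on {set 'I_n} as
   left multiplication on the coordinates in the basis of increasing products
   of generators; applied to the coordinates of 1 this gives a linear bijection
   from the quotient. *)

Local Notation M := {ffun {set 'I_n} -> F^o}.

Definition gsign (i : 'I_n) (T : {set 'I_n}) : F :=
  (-1) ^+ #|[set j in T | (j < i)%N]|.

Definition extmul (i : 'I_n) (f : M) : M :=
  [ffun T : {set 'I_n} => if i \in T then gsign i T * f (T :\ i) else 0].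

Fact extmul_linear (i : 'I_n) : linear (extmul i).
Proof.
move=> c f g; apply/ffunP => T; rewrite !ffunE; case: ifP => _.
  by rewrite mulrDr; congr (_ + _); rewrite [LHS]mulrCA.
by rewrite addr0 [RHS]mulr0.
Qed.

Fact gsignD1 (i j : 'I_n) (T : {set 'I_n}) : j \in T ->
  gsign i T = (if (j < i)%N then -1 else 1) * gsign i (T :\ j).
Proof.
move=> jT; rewrite /gsign (cardsD1 j) inE jT /= exprD; congr (_ * _).
  by case: (j < i)%N.
by congr (_ ^+ #|pred_of_set _|); apply/setP => l; rewrite !inE andbA.
Qed.

Fact extmulN (i j : 'I_n) (f : M) :
  extmul i (extmul j f) + extmul j (extmul i f) = 0.
Proof.
wlog: i j / (i <= j)%N => [th|].
  by case/orP: (leq_total i j) => /th // <-; rewrite addrC.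
rewrite leq_eqVlt => /orP[/eqP/val_inj->|ij].
  by apply/ffunP => T; rewrite !ffunE !inE eqxx /= mulr0 if_same addr0.
apply/ffunP => T; rewrite !ffunE !inE; have nij : i != j by rewrite neq_ltn ij.
rewrite nij eq_sym nij /=.
have [iT|] := boolP (i \in T); have [jT|] := boolP (j \in T);
  rewrite ?mulr0 ?addr0 //.
rewrite (gsignD1 i jT) (gsignD1 j iT) ij ltnNge (ltnW ij) /=.
rewrite mul1r mulN1r mulNr.
have -> : T :\ j :\ i = T :\ i :\ j by rewrite !setDDl setUC.
by rewrite mulrCA subrr.
Qed.

Definition extword (m : seq 'I_n) (f : M) : M := foldr extmul f m.

Fact extword_linear (m : seq 'I_n) : linear (extword m).
Proof.
elim: m => // i m IHm c f g.
have E h : extword (i :: m) h = extmul i (extword m h) by [].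
by rewrite !E IHm extmul_linear.
Qed.

Definition extact (p : A) (f : M) : M := \sum_(m <- msupp p) p@_m *: extword m f.

Fact extactEw (d : {fset {fmonom 'I_n}}) (p : A) (f : M) :
  (msupp p `<=` d)%fset -> extact p f = \sum_(m <- d) p@_m *: extword m f.
Proof.
move=> le; rewrite /extact (big_fset_incl _ le) => //= m _ /mcoeff_outdom ->.
by rewrite scale0r.
Qed.

Fact extact_linear_l (f : M) : linear (extact^~ f).
Proof.
move=> c p q; pose d := (msupp (c *: p + q) `|` (msupp p `|` msupp q))%fset.
rewrite (@extactEw d) ?fsubsetUl // (@extactEw d p); last first.
  by rewrite /d fsetUCA fsubsetUl.
rewrite (@extactEw d q); last by rewrite /d fsetUA fsubsetUr.
rewrite scaler_sumr -big_split; apply: eq_bigr => m _ /=.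
by rewrite mcoeffD mcoeffZ scalerDl scalerA.
Qed.

Fact extact_linear_r (p : A) : linear (extact p).
Proof.
move=> c f g; rewrite /extact scaler_sumr -big_split; apply: eq_bigr => m _ /=.
by rewrite extword_linear scalerDr !scalerA mulrC.
Qed.

HB.instance Definition _ i :=
  GRing.isLinear.Build F M M _ (extmul i) (extmul_linear i).
HB.instance Definition _ m :=
  GRing.isLinear.Build F M M _ (extword m) (extword_linear m).
HB.instance Definition _ p :=
  GRing.isLinear.Build F M M _ (extact p) (extact_linear_r p).
Definition extactl (f : M) (p : A) : M := extact p f.
HB.instance Definition _ f :=
  GRing.isLinear.Build F A M _ (extactl f) (extact_linear_l f).

Fact extactU (c : F) (m : {fmonom 'I_n}) (f : M) :
  extact << c *g m >> f = c *: extword m f.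
Proof. by rewrite (extactEw _ msuppU_le) big_seq_fset1 mcoeffUU. Qed.

Fact extactM (p q : A) (f : M) : extact (p * q) f = extact p (extact q f).
Proof.
rewrite malgME -/(extactl f _) linear_sum [RHS]/extact; apply: eq_bigr => m _.
rewrite linear_sum [in RHS]/extact linear_sum scaler_sumr.
apply: eq_bigr => m' _ /=; rewrite /extactl extactU linearZ /= scalerA.
by rewrite fmM /extword foldr_cat.
Qed.

Fact extact_gen (i : 'I_n) (f : M) : extact (free_gen F i) f = extmul i f.
Proof. by rewrite free_gen.unlock extactU scale1r fmU. Qed.

Fact extactD (p q : A) (f : M) : extact (p + q) f = extact p f + extact q f.
Proof. by have := extact_linear_l f 1 p q; rewrite !scale1r => ->. Qed.

Fact extactB (p q : A) (f : M) : extact (p - q) f = extact p f - extact q f.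
Proof.
have := extact_linear_l f (-1) q p; rewrite !scaleN1r (addrC _ p) => ->.
by rewrite addrC.
Qed.

Fact extact0 (f : M) : extact 0 f = 0.
Proof. by have := extactB 0 0 f; rewrite !subrr => ->. Qed.

Fact extact_ideal (p : A) (f : M) : p \in I -> extact p f = 0.
Proof.
move=> /grassmann_idealP Ip; elim: Ip f => {p}.
- move=> p [i [j ->]] f.
  have e l m : extact (free_gen F l * free_gen F m) f = extmul l (extmul m f).
    by rewrite extactM extact_gen extact_gen.
  apply: etrans (extactD _ _ _) _.
  by rewrite [X in X + _]e [X in _ + X]e extmulN.
- by move=> f; rewrite extact0.
- move=> p q _ p0 _ q0 f.
  by rewrite extactB p0 q0 subr0.
- by move=> a p _ p0 f; rewrite extactM p0 linear0.
- by move=> a p _ p0 f; rewrite extactM p0.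
Qed.

Definition grassmann_basis (T : {set 'I_n}) : G :=
  \prod_(i in T) grassmann_gen i.

Fact grassmann_gen_prod (i : 'I_n) (P : pred 'I_n) (r : seq 'I_n) :
  grassmann_gen i * \prod_(j <- r | P j) grassmann_gen j =
  (-1) ^+ count P r *: (\prod_(j <- r | P j) grassmann_gen j * grassmann_gen i).
Proof.
elim: r => [|j r IHr] /=; first by rewrite !big_nil mulr1 mul1r scale1r.
rewrite !big_cons; case: (P j) => //=.
rewrite mulrA (grassmann_genN i j) mulNr -(mulrA _ (grassmann_gen i)) IHr.
rewrite exprS mulN1r scaleNr.
by rewrite -scalerAr mulrA.
Qed.

Fact enum_ord_split (i : 'I_n) : exists r1 r2 : seq 'I_n,
  [/\ index_enum 'I_n = r1 ++ i :: r2, all (fun j : 'I_n => (j < i)%N) r1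
    & all (fun j : 'I_n => (i < j)%N) r2].
Proof.
have : i \in enum 'I_n by rewrite mem_enum.
have : sorted ltn (map val (enum 'I_n)) by rewrite val_enum_ord iota_ltn_sorted.
rewrite -[index_enum _]enumT => srt /path.splitPr.
move: srt => /[swap] -[r1 r2]; rewrite map_cat /= sorted_pairwise; last exact: ltn_trans.
rewrite pairwise_cat /= => /and3P[h1 _ /andP[h2 _]]; exists r1, r2; split=> //.
  apply/allP => j jr; have /allrelP := h1; apply; first exact: map_f.
  exact: mem_head.
by rewrite all_map in h2.
Qed.

Fact gsignE (i : 'I_n) (T : {set 'I_n}) (r1 r2 : seq 'I_n) :
    index_enum 'I_n = r1 ++ i :: r2 -> all (fun j : 'I_n => (j < i)%N) r1 ->
    all (fun j : 'I_n => (i < j)%N) r2 ->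
  gsign i T = (-1) ^+ count (mem T) r1.
Proof.
move=> e1 /allP h1 /allP h2; rewrite /gsign -sum1dep_card e1 big_cat big_cons /=.
rewrite ltnn andbF [X in (_ + X)%N]big_seq_cond [X in (_ + X)%N]big_pred0 ?addn0.
  rewrite -sum1_count big_seq_cond [in RHS]big_seq_cond; congr (_ ^+ _).
  apply: eq_bigl => j; case: (boolP (j \in r1)) => //= /h1 ->.
  by rewrite andbT.
move=> j /=; case: (boolP (j \in r2)) => //= /h2 ij.
by rewrite ltnNge (ltnW ij) andbF.
Qed.

Fact grassmann_gen_basis (i : 'I_n) (T : {set 'I_n}) :
  grassmann_gen i * grassmann_basis T =
  if i \in T then 0 else gsign i (i |: T) *: grassmann_basis (i |: T).
Proof.
have [r1 [r2 [e1 h1 h2]]] := enum_ord_split i.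
have nr (r : seq 'I_n) : i \notin r ->
    \prod_(j <- r | j \in i |: T) grassmann_gen j =
    \prod_(j <- r | j \in T) grassmann_gen j.
  move=> ir; rewrite big_seq_cond [RHS]big_seq_cond; apply: eq_bigl => j.
  rewrite !inE; case: (boolP (j \in r)) => //= jr; case: eqP => // ji.
  by rewrite ji (negPf ir) in jr.
have i1 : i \notin r1 by apply/negP => /(allP h1); rewrite ltnn.
have i2 : i \notin r2 by apply/negP => /(allP h2); rewrite ltnn.
have cnt : count (mem (i |: T)) r1 = count (mem T) r1.
  apply: eq_in_count => j jr; rewrite !inE; case: eqP => // ji.
  by rewrite ji (negPf i1) in jr.
rewrite /grassmann_basis e1 !big_cat !big_cons /= setU11 !nr //.
rewrite (gsignE _ e1 h1 h2) cnt !mulrA grassmann_gen_prod -scalerAl.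
case: ifP => iT; last by rewrite -!mulrA.
by rewrite -!mulrA (mulrA (grassmann_gen i)) grassmann_gen_sqr mul0r mulr0 scaler0.
Qed.

Definition grassmann_of (f : M) : G := \sum_T f T *: grassmann_basis T.

Fact grassmann_of_linear : linear grassmann_of.
Proof.
move=> c f g; rewrite /grassmann_of scaler_sumr -big_split; apply: eq_bigr => T _.
by rewrite !ffunE scalerDl scalerA.
Qed.

HB.instance Definition _ :=
  GRing.isLinear.Build F M G _ grassmann_of grassmann_of_linear.

Fact grassmann_of_extmul (i : 'I_n) (f : M) :
  grassmann_of (extmul i f) = grassmann_gen i * grassmann_of f.
Proof.
rewrite /grassmann_of mulr_sumr (bigID (fun T : {set 'I_n} => i \in T)) /=.
rewrite [X in _ + X]big1 ?addr0; last first.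
  by move=> T iT; rewrite ffunE (negPf iT) scale0r.
rewrite [RHS](bigID (fun T : {set 'I_n} => i \in T)) /=.
rewrite [X in _ = X + _]big1 ?add0r; last first.
  by move=> T iT; rewrite -scalerAr grassmann_gen_basis iT scaler0.
rewrite (reindex_onto (fun T : {set 'I_n} => i |: T) (fun T => T :\ i)) /=; last first.
  by move=> T iT; rewrite setD1K.
apply: eq_big => [T|T].
  rewrite setU11 /=; apply/eqP/idP => [<-|iT]; first by rewrite !inE eqxx.
  by rewrite setU1K.
rewrite setU11 /= => /eqP iT; have niT : i \notin T by rewrite -iT !inE eqxx.
rewrite ffunE setU11 iT -scalerAr grassmann_gen_basis (negPf niT) scalerA.
by rewrite [LHS]/(_ *: _) mulrC.
Qed.

Fact grassmann_of_extact (p : A) (f : M) :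
  grassmann_of (extact p f) = pi p * grassmann_of f.
Proof.
rewrite {2}(monalgE p) !linear_sum mulr_suml; apply: eq_bigr => m _.
have -> : << p@_m *g m >> = p@_m *: << m >> :> A.
  apply/malgP => m'; apply: etrans (mcoeffU _ _ _) _.
  apply: etrans _ (esym (mcoeffZ _ _ _)).
  by rewrite mcoeffU mulr_natr.
rewrite !linearZ -scalerAl; congr (_ *: _).
case: m => m; elim: m => [|i m IHm] /=.
  have -> : << FMonom [::] >> = 1 :> A by rewrite -fmoneE.
  by rewrite rmorph1 mul1r.
have -> : << FMonom (i :: m) >> = free_gen F i * << FMonom m >> :> A.
  rewrite free_gen.unlock malgM_def fgmulUU mulr1; congr << _ >>; apply/eqP.
  by rewrite fmP fmM fmU.
by rewrite rmorphM -mulrA -IHm grassmann_of_extmul.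
Qed.

Definition ext_delta (S : {set 'I_n}) : M := [ffun T => (T == S)%:R].

Fact grassmann_of_delta0 : grassmann_of (ext_delta set0) = 1.
Proof.
rewrite /grassmann_of (bigD1 set0) //= ffunE eqxx scale1r big1 ?addr0.
  by rewrite /grassmann_basis big_set0.
by move=> T /negPf T0; rewrite ffunE T0 scale0r.
Qed.

Fact extword_delta (S : {set 'I_n}) :
  extword (enum S) (ext_delta set0) = ext_delta S.
Proof.
have : sorted ltn (map val (enum S)).
  rewrite sorted_map; apply: (@subseq_sorted _ _ _ _ (enum 'I_n)).
  - by move=> ? ? ?; apply: ltn_trans.
  - by rewrite [enum S]/enum_mem -enumT filter_subseq.
  - by rewrite -sorted_map val_enum_ord iota_ltn_sorted.
have -> : S = [set j in enum S] by apply/setP => j; rewrite inE mem_enum.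
rewrite {1 2}(_ : enum [set j in enum S] = enum S); last first.
  by apply: eq_enum => j; rewrite inE mem_enum.
elim: (enum S) => [|i s IHs] /= srt.
  by congr ext_delta; apply/setP => j; rewrite !inE.
have srts : sorted ltn (map val s) by apply: path_sorted srt.
rewrite -/(extword _ _) (IHs srts); move: srt.
rewrite (path_sortedE ltn_trans) all_map => /andP[/allP lti _].
have nis : i \notin s by apply/negP => /lti /=; rewrite ltnn.
apply/ffunP => T; rewrite !ffunE.
have -> : (T == [set j in i :: s]) = (i \in T) && (T :\ i == [set j in s]).
  apply/eqP/andP => [->|[iT /eqP e]].
    rewrite inE mem_head; split=> //; apply/eqP/setP => j; rewrite !inE.
    by case: eqP => //= ->; rewrite (negPf nis).
  by rewrite -(setD1K iT) e; apply/setP => j; rewrite !inE.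
case: ifP => //= iT; case: eqP => e; rewrite ?mulr0 // mulr1.
rewrite /gsign (_ : [set j in T | _] = set0) ?cards0 //; apply/setP => j.
rewrite !inE; apply/negP => /andP[jT ji]; have : j \in T :\ i.
  by rewrite !inE jT andbT neq_ltn ji.
by rewrite e inE => /lti /=; rewrite ltnNge (ltnW ji).
Qed.

Definition grassmann_coord (x : G) : 'rV[F]_#|{set 'I_n}| :=
  \row_j extact (repr x) (ext_delta set0) (enum_val j).

Fact grassmann_coord_pi (p : A) :
  grassmann_coord (pi p) =
  \row_j extact p (ext_delta set0) (enum_val j).
Proof.
apply/rowP => j; rewrite !mxE; congr (fun_of_fin _ _); apply/eqP.
rewrite -subr_eq0 -extactB.
by apply/eqP/extact_ideal/grassmann_reprP.
Qed.

Fact grassmann_vect_iso : Vector.axiom #|{set 'I_n}| G.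
Proof.
exists grassmann_coord.
  move=> c x y; have [p ->] := grassmann_pi_surj x.
  have [q ->] := grassmann_pi_surj y.
  rewrite -linearP !grassmann_coord_pi; apply/rowP => j.
  by rewrite !mxE -/(extactl _ _) linearP !ffunE.
pose h (v : 'rV[F]_#|{set 'I_n}|) := grassmann_of [ffun T => v 0 (enum_rank T)].
exists h => [x|v].
  have [p ->] := grassmann_pi_surj x.
  rewrite grassmann_coord_pi /h (_ : finfun _ = extact p (ext_delta set0)).
    by rewrite grassmann_of_extact grassmann_of_delta0 mulr1.
  by apply/ffunP => T; rewrite ffunE mxE enum_rankK.
pose p : A := \sum_T v 0 (enum_rank T) *: << FMonom (enum T) >>.
have ep : extact p (ext_delta set0) = [ffun T => v 0 (enum_rank T)].
  rewrite -/(extactl _ _) /p linear_sum; apply/ffunP => S; rewrite sum_ffunE ffunE.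
  rewrite (bigD1 S) //= big1 ?addr0 => [|T TS].
    by rewrite linearZ /= ffunE /extactl extactU scale1r extword_delta ffunE eqxx [LHS]mulr1.
  by rewrite linearZ /= ffunE /extactl extactU scale1r extword_delta ffunE eq_sym (negPf TS) [LHS]mulr0.
rewrite /h -ep grassmann_of_extact grassmann_of_delta0 mulr1 grassmann_coord_pi.
by apply/rowP => j; rewrite mxE ep ffunE enum_valK.
Qed.

HB.instance Definition _ := Lmodule_hasFinDim.Build F G grassmann_vect_iso.
HB.instance Definition _ := Algebra_isFalgebra.Build F G.

Lemma dim_grassmann : \dim {: G} = (2 ^ n)%N.
Proof. by rewrite dimvf /dim /= -cardsT -powersetT card_powerset cardsT card_ord. Qed.

End GrassmannAlgebra.

Definition commutative_subalgebra (F : fieldType) (B : falgType F)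
    (A : {vspace B}) : Prop :=
  [/\ 1 \in A, {in A &, forall x y, x * y \in A}
    & {in A &, forall x y, x * y = y * x}].

Definition maximal_commutative_subalgebra (F : fieldType) (B : falgType F)
    (A : {vspace B}) : Prop :=
  commutative_subalgebra A /\
  forall A' : {vspace B}, commutative_subalgebra A' -> (A <= A')%VS -> A' = A.

(* Main.v *)
(** For odd n the centre of G(n) contains the even part, and two odd elements
    commute iff their product vanishes. Hence, if I is a family of odd-size
    subsets of the generators that is pairwise intersecting and maximal among
    such families, the span of the monomials indexed by the even-size sets and
    by I is a maximal commutative subalgebra, of dimension 2^(n-1) + #|I|.

    To get #|I| < 2^(n-2), split the n = 5 + m generators, m = 4(k-1), into blocks
    D, B, C, A of sizes 1, 2, 2, m. Consider the sets S such that
    - if D is in S, either S meets both B and C, or |S :&: A| >= m/2;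
    - if D is not in S, |S :&: A| > m/2 and S contains B or C.
    They form a maximal intersecting family (a self-dual monotone condition)
    whose minimal members all have odd size, so its odd-size members form a
    maximal intersecting family of odd-size sets. Comparing parities shows that
    there are 2^(n-2) - 'C(m, m/2)/2 of them. *)

Require Import Defs.
From mathcomp Require Import all_boot all_order all_algebra all_field.
From mathcomp Require Import zify.

Set Implicit Arguments.
Unset Strict Implicit.
Unset Printing Implicit Defensive.

Import GRing.Theory.

(** * Subsets counted by parity *)

(** Toggling the membership of [i] is an involution that flips the parity. *)
Lemma card_parity_subsets (I : finType) (i : I) :
  #|[set T : {set I} | odd #|T|]| = #|[set T : {set I} | ~~ odd #|T|]|.
Proof.
pose f (T : {set I}) := if i \in T then T :\ i else i |: T.
have fK : involutive f.
  move=> T; rewrite /f; case: (boolP (i \in T)) => iT; last by rewrite setU11 setU1K.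
  by rewrite setD11 setD1K.
have fodd T : odd #|f T| = ~~ odd #|T|.
  rewrite /f; case: ifP => iT; last by rewrite cardsU1 iT.
  by rewrite [in RHS](cardsD1 i) iT negbK.
rewrite -(card_imset _ (inv_inj fK)); apply: eq_card => T; rewrite inE.
apply/imsetP/idP => [[S]|eT]; first by rewrite inE => oS ->; rewrite fodd oS.
by exists (f T); rewrite ?fK // inE fodd.
Qed.

Lemma card_even_subsets n :
  #|[set T : {set 'I_n.+1} | ~~ odd #|T|]| = (2 ^ n)%N.
Proof.
apply/eqP; rewrite -(eqn_pmul2l (isT : 0 < 2)) -expnS mul2n -addnn.
rewrite -{1}(card_parity_subsets ord0) -[X in _ == 2 ^ X]card_ord -cardsT.
rewrite -card_powerset powersetT -(cardsID [set T : {set _} | odd #|T|] setT) setTI.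
by apply/eqP; congr (_ + _)%N; apply: eq_card => T; rewrite !inE ?andbT.
Qed.

Lemma subset_of_card (I : finType) (A : {set I}) r : r <= #|A| ->
  exists2 B : {set I}, B \subset A & #|B| = r.
Proof.
move=> le_rA; have /card_gt0P[B] : 0 < #|[set B : {set I} | B \subset A & #|B| == r]|.
  by rewrite cards_draws bin_gt0.
by rewrite inE => /andP[BA /eqP]; exists B.
Qed.

(** * The intersecting family of odd sets *)

Section Family.
Variable h : nat.
Hypotheses (h_gt0 : 0 < h) (h_even : ~~ odd h).
Local Notation m := h.*2.
Local Notation bits := (bool * bool * bool * bool * bool)%type.

(* A subset of 'I_(5 + m) is coded by its trace (d, b, b', c, c') on the blocks
   D = {0}, B = {1, 2}, C = {3, 4}, and its trace T on the block A. *)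
Definition mark (u : bits) (j : nat) : bool :=
  let: (d, b, b', c, c') := u in nth false [:: d; b; b'; c; c'] j.

Definition glue (u : bits) (T : {set 'I_m}) : {set 'I_(5 + m)} :=
  [set i | match split i with inl j => mark u j | inr j => j \in T end].

Lemma in_glue_l u T j : (lshift m j \in glue u T) = mark u j.
Proof. by rewrite inE (unsplitK (inl j)). Qed.

Lemma in_glue_r u T j : (rshift 5 j \in glue u T) = (j \in T).
Proof. by rewrite inE (unsplitK (inr j)). Qed.

Lemma glue_surj S : exists u T, S = glue u T.
Proof.
pose s j := lshift m (inord j : 'I_5) \in S.
exists (s 0, s 1, s 2, s 3, s 4), [set j | rshift 5 j \in S].
apply/setP => i; rewrite -[i]splitK; case: (split i) => j /=.
  rewrite in_glue_l -[in LHS](inord_val j).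
  by case: j => -[|[|[|[|[|]]]]].
by rewrite in_glue_r inE.
Qed.

Definition weight (u : bits) : nat :=
  let: (d, b, b', c, c') := u in (d + b + b' + c + c')%N.

Lemma card_glue u T : #|glue u T| = (weight u + #|T|)%N.
Proof.
rewrite -sum1_card big_mkcond big_split_ord /=; congr (_ + _)%N.
  under eq_bigr do rewrite in_glue_l.
  by rewrite !big_ord_recl big_ord0 /=; case: u => [[[[[] []] []] []] []].
under eq_bigr do rewrite in_glue_r.
by rewrite -big_mkcond sum1_card.
Qed.

Definition compatible (u v : bits) : bool :=
  let: (d, b, b', c, c') := u in let: (e, f, f', g, g') := v in
  ~~ [|| d && e, b && f, b' && f', c && g | c' && g'].

Lemma disjoint_glue u v T T' :
  [disjoint glue u T & glue v T'] = compatible u v && [disjoint T & T'].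
Proof.
apply/idP/andP => [dis|[uv dis]].
  have /setDidPl/setP dis' := dis.
  split; last first.
    rewrite -setI_eq0; apply/eqP/setP => j; rewrite !inE.
    have := dis' (rshift 5 j); rewrite inE !in_glue_r.
    by case: (j \in T'); case: (j \in T).
  have H j (lt_j5 : j < 5) : ~~ (mark u j && mark v j).
    have := dis' (lshift m (Ordinal lt_j5)); rewrite inE !in_glue_l.
    by case: (mark v _); case: (mark u _).
  move: (H 0 isT) (H 1 isT) (H 2 isT) (H 3 isT) (H 4 isT).
  case: u {dis dis' H} => [[[[? ?] ?] ?] ?].
  by case: v => [[[[? ?] ?] ?] ?] /=; do 4!move=> /negPf->; move=> /negPf->.
rewrite -setI_eq0; apply/eqP/setP => i; rewrite in_setI in_set0 -[i]splitK.
case: (split i) => j /=; last by rewrite !in_glue_r; apply/andP => -[/(disjointFr dis)->].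
rewrite !in_glue_l; apply: negbTE; move: uv; case: u => [[[[? ?] ?] ?] ?].
case: v => [[[[? ?] ?] ?] ?] /=; rewrite !negb_or => /and5P[? ? ? ? ?].
by case: j => -[|[|[|[|[|]]]]].
Qed.

(* p, le and lt stand for the parity of #|T|, h <= #|T| and h < #|T|: counting
   the family then only requires five numbers of subsets of A. *)
Definition trace_cond (u : bits) (p le lt : bool) : bool :=
  let: (d, b, b', c, c') := u in
  (odd (weight u) (+) p) &&
  (if d then (b || b') && (c || c') || le else lt && (b && b' || c && c')).

Definition code : {set bits * {set 'I_m}} :=
  [set x : bits * {set 'I_m} | trace_cond x.1 (odd #|x.2|) (h <= #|x.2|) (h < #|x.2|)].

Definition family : {set {set 'I_(5 + m)}} := [set glue x.1 x.2 | x in code].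

Lemma family_odd S : S \in family -> odd #|S|.
Proof.
case/imsetP => -[u T]; rewrite inE /= => + ->; rewrite card_glue oddD.
by case: u => [[[[? ?] ?] ?] ?] /andP[].
Qed.

(** A member without D has more than [h] points in A and contains B or C. A disjoint member would
    then have fewer than [h] points in A, so it would contain D and meet both B and C, a
    contradiction. *)
Lemma family_intersecting (S S' : {set 'I_(5 + m)}) :
  S \in family -> S' \in family -> ~~ [disjoint S & S'].
Proof.
move=> /imsetP[[u T] + ->] /imsetP[[v T'] + ->]; rewrite !inE /=.
rewrite disjoint_glue => uT vT'; apply/negP => /andP[uv dT].
have : #|T| + #|T'| <= m.
  have /eqP <- : #|T :|: T'| == #|T| + #|T'|.
    by rewrite (leq_card_setU T T').2.
  by rewrite -[leqRHS]card_ord max_card.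
move: uT vT' uv {dT}; case: u => [[[[d b] b'] c] c'].
case: v => [[[[e f] f'] g] g'] /andP[_ +] /andP[_ +].
case: d; case: e => //=.
- case/orP => [bc|?] /andP[? fg] uv ?; last lia.
  by case: b b' c c' f f' g g' bc fg uv => -[] [] [] [] [] [] [].
- case/andP => ? bc /orP[fg|?] uv ?; last lia.
  by case: b b' c c' f f' g g' bc fg uv => -[] [] [] [] [] [] [].
- by case/andP => ? _ /andP[? _]; lia.
Qed.

(** The disjoint member is always a minimal one: B or C with [h.+1] points of A, D with [h] points
    of A, or D with one point of each of B and C. *)
Lemma family_maximal (S : {set 'I_(5 + m)}) : odd #|S| -> S \notin family ->
  exists2 S' : {set 'I_(5 + m)}, S' \in family & [disjoint S & S'].
Proof.
have [u [T ->]] := glue_surj S; rewrite card_glue oddD => odd_uT nF.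
have subT r : r + #|T| <= h + h -> exists2 T' : {set 'I_m}, [disjoint T & T'] & #|T'| = r.
  move=> le_rm; have [|T' T'T cT'] := @subset_of_card _ (~: T) r.
    rewrite cardsCs setCK card_ord leq_subRL; last by rewrite -[leqRHS]card_ord max_card.
    by rewrite addnC -[X in _ <= X]addnn.
  by exists T'; rewrite // disjoint_sym disjoints_subset.
have mem v (T' : {set 'I_m}) : trace_cond v (odd #|T'|) (h <= #|T'|) (h < #|T'|) ->
    compatible u v -> [disjoint T & T'] ->
    exists2 S' : {set 'I_(5 + m)}, S' \in family & [disjoint glue u T & S'].
  move=> vT' uv TT'; exists (glue v T'); last by rewrite disjoint_glue uv.
  by apply/imsetP; exists (v, T'); rewrite ?inE.
have {nF} : ~~ trace_cond u (odd #|T|) (h <= #|T|) (h < #|T|).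
  by apply: contra nF => uT; apply/imsetP; exists (u, T); rewrite ?inE.
move: odd_uT; case: u mem => [[[[d b] b'] c] c'] mem; rewrite /trace_cond => -> /=.
case: d mem => mem.
  rewrite negb_or negb_and -ltnNge => /andP[bc lt_Th].
  have [|T' dT cT'] := subT h.+1; first by rewrite addSn -addnS leq_add2l.
  case/orP: bc => /norP[/negPf nb /negPf nb'].
    apply: (mem (false, true, true, false, false) T') => //=; last by rewrite nb nb' !andbF.
    by rewrite cT' /= h_even ltnSn.
  apply: (mem (false, false, false, true, true) T') => //=; last by rewrite nb nb' !andbF.
  by rewrite cT' /= h_even ltnSn.
rewrite negb_and -leqNgt => /orP[le_Th|].
  have [|T' dT cT'] := subT h; first by rewrite leq_add2l.
  apply: (mem (true, false, false, false, false) T') => //=.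
    by rewrite cT' leqnn (negPf h_even).
  by rewrite !andbF.
rewrite negb_or => bc.
have [|T' dT cT'] := subT 0; first by rewrite add0n addnn -[leqRHS]card_ord max_card.
(* Neither block lies inside S, so each has a point outside: the first if S misses it, the second
   otherwise. *)
apply: (mem (true, ~~ b, b, ~~ c, c) T') => //=; rewrite ?cT'.
  by case: (b) (c) => -[].
by case: (b) (b') (c) (c') bc => -[] [] [].
Qed.

(** * Counting the family *)

Definition count_sets (p : pred nat) := #|[set T : {set 'I_m} | p #|T|]|.

Lemma count_setsE p : count_sets p = \sum_(T : {set 'I_m}) p #|T|.
Proof. by rewrite /count_sets -sum1dep_card big_mkcond. Qed.

Lemma count_setsC p : count_sets p = count_sets (fun t => p (m - t)).
Proof.
rewrite /count_sets -(card_imset _ (inv_inj (@setCK _))); apply: eq_card => T.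
have cT (S : {set 'I_m}) : #|~: S| = m - #|S| by rewrite cardsCs setCK card_ord.
rewrite inE; apply/imsetP/idP => [[S + ->]|pT].
  by rewrite inE cT subKn // -[leqRHS]card_ord max_card.
by exists (~: T); rewrite ?setCK // inE cT.
Qed.

Let even_gt := count_sets (fun t => ~~ odd t && (h < t)).
Let odd_gt := count_sets (fun t => odd t && (h < t)).
Let mid := count_sets (eq_op h).

(* Complementation T |-> ~: T preserves parity, m being even, so the sets with
   fewer than h elements are counted by even_gt and odd_gt as well. *)
Lemma count_sets_class (g : bool -> bool -> bool -> bool) :
  count_sets (fun t => g (odd t) (h <= t) (h < t)) =
  (g false false false + g false true true) * even_gt + g false true false * mid
  + (g true false false + g true true true) * odd_gt.
Proof.
have lowC (b : bool) : count_sets (fun t => (odd t == b) && (h < t)) =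
    count_sets (fun t => (odd t == b) && (t < h)).
  rewrite count_setsC !count_setsE; apply: eq_bigr => T _; congr (nat_of_bool _).
  have leT : #|T| <= m by rewrite -[leqRHS]card_ord max_card.
  by rewrite oddB // odd_double /=; congr (_ && _); lia.
have -> : even_gt = count_sets (fun t => (odd t == false) && (h < t)).
  by rewrite /even_gt !count_setsE; apply: eq_bigr => T _; rewrite eqbF_neg.
have -> : odd_gt = count_sets (fun t => (odd t == true) && (h < t)).
  by rewrite /odd_gt !count_setsE; apply: eq_bigr => T _; rewrite eqb_id.
rewrite /mid !mulnDl {1}(lowC false) {1}(lowC true) !count_setsE !big_distrr -!big_split /=.
apply: eq_bigr => T _; case: ltngtP => [lt|gt|eq]; case: (boolP (odd _)) => oT /=;
  rewrite ?muln0 ?muln1 ?addn0 //.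
by move: oT; rewrite -eq (negPf h_even).
Qed.

Lemma mid_gt0 : 0 < mid.
Proof.
have [|T _ cT] := @subset_of_card _ [set: 'I_m] h; first by rewrite cardsT card_ord; lia.
by apply/card_gt0P; exists T; rewrite inE cT.
Qed.

Lemma card_family : #|family| < 2 ^ m.+3.
Proof.
have ord0m : 'I_m by exists 0; lia.
(* The middle layer consists of even sets, so equality of the odd and even counts forces an excess
   of odd sets above it; the strict bound comes from this excess. *)
have odd_eq_even : odd_gt.*2 = even_gt.*2 + mid.
  have /= oddC := count_sets_class (fun p _ _ => p).
  have /= evenC := count_sets_class (fun p _ _ => ~~ p).
  have := card_parity_subsets ord0m.
  rewrite -[LHS]/(count_sets odd) -[RHS]/(count_sets (fun t => ~~ odd t)) oddC evenC.
  lia.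
have total : (even_gt + odd_gt).*2 + mid = 2 ^ m.
  have := card_powerset [set: 'I_m]; rewrite cardsT card_ord powersetT => <-.
  have -> : #|[set: {set 'I_m}]| = count_sets xpredT by apply: eq_card => T; rewrite !inE.
  rewrite (count_sets_class (fun _ _ _ => true)) /=; lia.
have bits_sum (G : bits -> nat) :
    \sum_u G u = \sum_d \sum_b \sum_b' \sum_c \sum_c' G (d, b, b', c, c').
  by rewrite !pair_bigA; apply: eq_bigr => -[[[[]]]].
have code_count : #|code| =
    \sum_(u : bits) count_sets (fun t => trace_cond u (odd t) (h <= t) (h < t)).
  under [RHS]eq_bigr do rewrite count_setsE.
  by rewrite pair_bigA -sum1dep_card big_mkcond.
apply: (leq_ltn_trans (leq_imset_card _ _)); rewrite code_count.
under eq_bigr do rewrite count_sets_class.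
rewrite bits_sum !big_bool /= !expnS -total.
(* With e = even_gt, o = odd_gt, c = mid, the sum is 17 e + 8 c + 15 o, while
   2 ^ m.+3 is 16 e + 8 c + 16 o and 2 o = 2 e + c. *)
have := mid_gt0; lia.
Qed.
End Family.

Local Open Scope ring_scope.

(** * Products and commutators of basis monomials *)

Section Basis.
Variables (F : fieldType) (charF : 2%N \notin [pchar F]) (n : nat).
Local Notation G := (grassmann charF n).
Local Notation e := (@grassmann_basis F charF n).
Local Notation gen := (@grassmann_gen F charF n).

Lemma two_neq0 : (2 : F) != 0.
Proof. by apply: contra charF => c2; rewrite inE. Qed.

Lemma grassmann_of_surj (x : G) : exists f, x = grassmann_of charF f.
Proof.
have [p ->] := grassmann_pi_surj x; exists (extact p (ext_delta F set0)).
by rewrite grassmann_of_extact grassmann_of_delta0 mulr1.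
Qed.

(** A surjection between spaces of the same dimension [2 ^ n] has trivial kernel. *)
Lemma grassmann_of_inj : injective (grassmann_of charF (n := n)).
Proof.
pose f := linfun (grassmann_of charF (n := n)).
have f_onto : limg f = fullv.
  apply/eqP; rewrite eqEsubv subvf; apply/subvP => x _.
  by have [y ->] := grassmann_of_surj x; rewrite -[grassmann_of _ _]lfunE memv_img ?memvf.
suff /lker0P f_inj : lker f == 0%VS by move=> x y xy; apply: f_inj; rewrite !lfunE.
rewrite -dimv_eq0 -[lker f]capfv -(eqn_add2r (\dim (limg f))) limg_ker_dim.
rewrite f_onto dim_grassmann dimvf /dim /= muln1 add0n.
by rewrite -cardsT -powersetT card_powerset cardsT card_ord.
Qed.

Lemma basisU1 (i : 'I_n) (S : {set 'I_n}) : i \in S ->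
  exists b : bool, e S = (-1) ^+ b *: (gen i * e (S :\ i)).
Proof.
move=> iS; exists (odd #|[set j in i |: (S :\ i) | (j < i)%N]|).
rewrite grassmann_gen_basis !inE eqxx /= /gsign signr_odd scalerA -expr2 sqrr_sign.
by rewrite scale1r setD1K.
Qed.

Lemma gen_basis_comm (i : 'I_n) (T : {set 'I_n}) :
  gen i * e T = (-1) ^+ #|T| *: (e T * gen i).
Proof.
rewrite /grassmann_basis grassmann_gen_prod; congr (_ ^+ _ *: _).
by rewrite -sum1_count -sum1_card.
Qed.

Lemma basis_comm (S T : {set 'I_n}) :
  e S * e T = (-1) ^+ (#|S| * #|T|) *: (e T * e S).
Proof.
elim: {S}_.+1 {-2}S (ltnSn #|S|) => // r IHr S; rewrite ltnS => leS.
have [->|[i iS]] := set_0Vmem S.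
  by rewrite cards0 /grassmann_basis big_set0 mul1r mulr1 scale1r.
have [b ->] := basisU1 iS; move: leS; rewrite (cardsD1 i) iS => leS.
rewrite -!scalerAl -!scalerAr -mulrA (IHr _ leS) -scalerAr mulrA (gen_basis_comm i T).
rewrite -scalerAl -mulrA !scalerA mulSn exprD; congr (_ *: _).
by rewrite mulrC [X in _ * X]mulrC mulrA.
Qed.

Lemma basis_mul (S T : {set 'I_n}) : exists b : bool,
  e S * e T = if [disjoint S & T] then (-1) ^+ b *: e (S :|: T) else 0.
Proof.
elim: {S}_.+1 {-2}S (ltnSn #|S|) => // r IHr S; rewrite ltnS => leS.
have [->|[i iS]] := set_0Vmem S.
  exists false; rewrite disjoints_subset sub0set set0U scale1r.
  by rewrite {1}/grassmann_basis big_set0 mul1r.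
have [b eS] := basisU1 iS; move: leS; rewrite (cardsD1 i) iS => leS.
have [b' eST] := IHr _ leS.
have [dST|ndST] := boolP [disjoint S & T].
  have dS'T : [disjoint S :\ i & T] by apply: disjointWl dST; apply: subD1set.
  rewrite dS'T in eST.
  exists (b (+) b' (+) odd #|[set j in i |: (S :\ i :|: T) | (j < i)%N]|).
  rewrite eS -scalerAl -mulrA eST -scalerAr grassmann_gen_basis.
  rewrite !inE eqxx (disjointFr dST iS) /= setUA setD1K // /gsign.
  by rewrite !scalerA !signr_addb signr_odd.
exists false; rewrite eS -scalerAl -mulrA eST.
case: ifP => dS'T; last by rewrite mulr0 scaler0.
(* Here [S :\ i] avoids T but S does not, so [i] is in T and [gen i] kills the product. *)
rewrite -scalerAr grassmann_gen_basis ifT ?scaler0 // !inE eqxx /=.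
apply: contraR ndST => niT; rewrite -(setD1K iS) -setI_eq0 setIUl setU_eq0.
by rewrite !setI_eq0 disjoints1 niT.
Qed.

Definition basis_span (P : {set {set 'I_n}}) : {vspace G} :=
  <<[seq e T | T <- enum P]>>%VS.

Lemma dim_basis_span P : (\dim (basis_span P) <= #|P|)%N.
Proof. by rewrite (leq_trans (dim_span _)) // size_map cardE. Qed.

Lemma basis_in_span (P : {set {set 'I_n}}) T : T \in P -> e T \in basis_span P.
Proof. by move=> PT; rewrite memv_span // map_f // mem_enum. Qed.

Lemma basis_span_mul (P : {set {set 'I_n}}) :
  {in P &, forall S T, e S * e T \in basis_span P} ->
  {in basis_span P &, forall x y, x * y \in basis_span P}.
Proof.
move=> PM x y; have im u : u \in [seq e T | T <- enum P] -> exists2 T, T \in P & u = e T.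
  by case/mapP => T; rewrite mem_enum; exists T.
set X := [seq _ | _ <- _] in im *.
rewrite {1 2}/basis_span -/X -[X]/(tval (in_tuple X)) => /coord_span-> /coord_span->.
rewrite mulr_suml; apply: rpred_sum => i _; rewrite mulr_sumr; apply: rpred_sum => j _.
rewrite -scalerAl -scalerAr !rpredZ //.
have [S PS ->] := im _ (mem_nth 0 (ltn_ord i)).
have [T PT ->] := im _ (mem_nth 0 (ltn_ord j)).
exact: PM.
Qed.

Lemma basis_span_comm (P : {set {set 'I_n}}) :
  {in P &, forall S T, e S * e T = e T * e S} ->
  {in basis_span P &, forall x y, x * y = y * x}.
Proof.
have comm_span (y : G) : (forall T, T \in P -> e T * y = y * e T) ->
    forall x, x \in basis_span P -> x * y = y * x.
  move=> Py x Px; apply/cent1vP; apply: subvP x Px; apply/span_subvP => _ /mapP[T + ->].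
  by rewrite mem_enum => PT; apply/cent1vP/Py.
(* Commuting with a fixed element is a linear condition; it is extended from monomials to the span
   in one argument, then in the other. *)
move=> PC x y Px Py; apply: (comm_span y) => // T PT.
by apply/esym; apply: (comm_span) Py => S PS; apply: PC.
Qed.

(** Swapping the factors costs the sign [(-1) ^+ #|T|], so the commutator is 0 or twice the product;
    characteristic other than two keeps the latter nonzero. *)
Lemma commutator_basis (S : {set 'I_n}) : odd #|S| -> forall T : {set 'I_n},
  exists2 c : F, e T * e S - e S * e T = c *: e (T :|: S)
    & (c != 0) = odd #|T| && [disjoint T & S].
Proof.
move=> oS T; have [b eTS] := basis_mul T S.
exists (if [disjoint T & S] then (1 - (-1) ^+ odd #|T|) * (-1) ^+ b else 0).
  rewrite (basis_comm S) -signr_odd oddM oS andTb -{1}[e T * e S]scale1r -scalerBl eTS.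
  by case: ifP => _; rewrite ?scaler0 ?scale0r // scalerA.
case: ifP => dTS; last by rewrite eqxx andbF.
rewrite andbT mulf_eq0 signr_eq0 orbF; case: (odd _); last by rewrite subrr eqxx.
by rewrite opprK two_neq0.
Qed.

End Basis.

(** * From maximal intersecting families to maximal commutative subalgebras *)

Section Maximal.
Variables (F : fieldType) (charF : 2%N \notin [pchar F]) (n : nat).
Local Notation e := (@grassmann_basis F charF n).

Variable I : {set {set 'I_n}}.
Hypothesis I_odd : forall S, S \in I -> odd #|S|.
Hypothesis I_intersecting : forall S T : {set 'I_n},
  S \in I -> T \in I -> ~~ [disjoint S & T].
Hypothesis I_maximal : forall S : {set 'I_n}, odd #|S| -> S \notin I ->
  exists2 T : {set 'I_n}, T \in I & [disjoint S & T].

Let P := [set T : {set 'I_n} | ~~ odd #|T|] :|: I.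

Lemma commutative_intersecting_span : commutative_subalgebra (basis_span charF P).
Proof.
split.
- have <- : e set0 = 1 by rewrite /grassmann_basis big_set0.
  by apply: basis_in_span; rewrite !inE cards0.
- apply: basis_span_mul => S T PS PT; have [b ->] := basis_mul charF S T.
  case: ifP => dST; last exact: rpred0.
  rewrite rpredZ // basis_in_span // !inE.
  have cST : #|S :|: T| = (#|S| + #|T|)%N by apply/eqP; rewrite (leq_card_setU S T).2.
  rewrite cST oddD; move: PS PT; rewrite !inE.
  (* Maximality makes [I] upward closed among odd sets, which handles a product of an odd and an
     even monomial. *)
  have upward (A B : {set 'I_n}) : A \in I -> A \subset B -> odd #|B| -> B \in I.
    move=> IA AB oB; apply: contraT => /(I_maximal oB)[C IC dBC].
    by case/negP: (I_intersecting IA IC); apply: disjointWl dBC.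
  have [oS|eS] := boolP (odd #|S|); have [oT|eT] //= := boolP (odd #|T|) => IS IT.
  + by rewrite (upward S) ?subsetUl // cST oddD oS (negPf eT).
  + by rewrite (upward T) ?subsetUr // cST oddD oT (negPf eS).
- apply: basis_span_comm => S T PS PT.
  have [|oST] := boolP (odd (#|S| * #|T|)); last first.
    by rewrite basis_comm -signr_odd (negPf oST) scale1r.
  rewrite oddM => /andP[oS oT]; have := I_intersecting (S := S) (T := T).
  move: PS PT; rewrite !inE oS oT /= => IS IT /(_ IS IT)/negPf dST.
  have [b ->] := basis_mul charF S T; have [b' ->] := basis_mul charF T S.
  by rewrite dST disjoint_sym dST.
Qed.

Lemma maximal_intersecting_span : maximal_commutative_subalgebra (basis_span charF P).
Proof.
split=> [|B [_ _ BC] PB]; first exact: commutative_intersecting_span.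
apply/eqP; rewrite eqEsubv PB andbT; apply/subvP => x Bx.
have [f def_x] := grassmann_of_surj x; rewrite def_x.
apply: rpred_sum => T _; have [PT|nPT] := boolP (T \in P).
  by rewrite rpredZ // basis_in_span.
suff -> : f T = 0 by rewrite scale0r rpred0.
move: nPT; rewrite !inE negb_or negbK => /andP[oT /(I_maximal oT)[S IS dTS]].
(* If T is odd and not in I, some S in I is disjoint from T; the coefficient of
   e_(T :|: S) in the commutator of x and e_S is then a nonzero multiple of f T. *)
have Be : e S \in B by apply: (subvP PB); rewrite basis_in_span // !inE IS orbT.
have /fin_all_exists2[c defc c_neq0] := commutator_basis charF (I_odd IS).
have /eqP := BC _ _ Bx Be; rewrite def_x -subr_eq0 /grassmann_of mulr_suml mulr_sumr -sumrB.
(* [h] collects the coordinates of the commutator, grouped by the union [U :|: S]. *)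
pose h := [ffun R => \sum_(U | U :|: S == R) f U * c U] : {ffun {set 'I_n} -> F^o}.
rewrite [X in X == 0](_ : _ = grassmann_of charF h); last first.
  rewrite /grassmann_of (partition_big (fun U => U :|: S) predT) //=.
  apply: eq_bigr => R _; rewrite ffunE scaler_suml; apply: eq_bigr => U /eqP <-.
  by rewrite -scalerAl -scalerAr -scalerBr defc scalerA.
rewrite -(linear0 (grassmann_of charF (n := n))) => /eqP/grassmann_of_inj/ffunP/(_ (T :|: S)).
(* Only [U = T] contributes: any other U with the same union meets S, so [c U] vanishes. *)
rewrite !ffunE (bigD1 T) //= big1 ?addr0 => [/eqP|U /andP[/eqP UST nUT]].
  have := c_neq0 T; rewrite oT dTS mulf_eq0 => /negPf->; rewrite orbF.
  exact: eqP.
have /negPf ndUS : ~~ [disjoint U & S].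
  apply: contra nUT => dUS; apply/eqP.
  have: (U :|: S) :\: S = (T :|: S) :\: S by rewrite UST.
  by rewrite !setDUl setDv !setU0 !(setDidPl _).
by apply/eqP; rewrite mulf_eq0 -[c U == 0]negbK c_neq0 ndUS andbF orbT.
Qed.

Lemma dim_intersecting_span :
  (\dim (basis_span charF P) <= #|[set T : {set 'I_n} | ~~ odd #|T|]| + #|I|)%N.
Proof. by rewrite (leq_trans (dim_basis_span _ _)) // leq_card_setU. Qed.
End Maximal.

Theorem theorem1 (F : fieldType) (charF : 2%N \notin [pchar F]) (k n : nat)
    (k_ge4 : (4 <= k)%N) (n_def : n = (4 * k + 1)%N) :
  exists A : {vspace grassmann charF n},
    maximal_commutative_subalgebra A /\ (\dim A < 3 * 2 ^ (n - 2))%N.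
Proof.
(* Half the size [4 * (k - 1)] of the block A. *)
pose h := (k.-1).*2.
have h_even : ~~ odd h by rewrite odd_double.
have h_gt0 : (0 < h)%N by rewrite double_gt0; lia.
have {n_def} -> : n = (5 + h.*2)%N by rewrite n_def /h; lia.
exists (basis_span charF ([set T : {set _} | ~~ odd #|T|] :|: family h)); split.
  apply: maximal_intersecting_span => [S|S T|S].
  - exact: family_odd.
  - exact: family_intersecting.
  - exact: family_maximal.
apply: leq_ltn_trans (dim_intersecting_span _ _) _.
(* The even sets contribute [2 ^ (n - 1)], twice [2 ^ (n - 2)], and the family less than
   [2 ^ (n - 2)]. *)
rewrite (card_even_subsets (4 + h.*2)) addSn subSS addSn subSS subn0.
have := card_family h_gt0 h_even; rewrite !expnS; lia.
Qed.
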